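(* Let $S$ be an $s$-local semiring with unique maximal semisubtractive ideal $\mathfrak{m}$, let $X$ be the set of all multiplicatively cancellable elements of $S$, and suppose that $X\cap\mathfrak{m}=\emptyset$. Then the localization $S_X$ is an $s$-local semiring with unique maximal semisubtractive ideal $\mathfrak{m}S_X$.
   Context: A semiring $S$ means a commutative semiring with multiplicative identity $1$, with $0\neq 1$. An ideal of $S$ is an additive submonoid $\mathfrak{a}$ of $S$ with $sx\in\mathfrak{a}$ for all $s\in S$, $x\in\mathfrak{a}$. $\mathcal{V}(S)$ denotes the set of elements $x\in S$ having an additive inverse $-x$ in $S$. An ideal $\mathfrak{a}$ is semisubtractive if $x\in\mathfrak{a}\cap\mathcal{V}(S)$ implies $-x\in\mathfrak{a}\cap\mathcal{V}(S)$. A maximal semisubtractive ideal is a proper semisubtractive ideal that is maximal among proper semisubtractive ideals. $S$ is $s$-local if it has a unique maximal semisubtractive ideal. An element $x\in S$ is multiplicatively cancellable if $xa=xb$ implies $a=b$. $S_X$ denotes the localization of $S$ at the multiplicative set $X$ (semiring of fractions $\frac{a}{x}$, $a\in S$, $x\in X$, constructed as for rings), and for an ideal $\mathfrak{a}$ of $S$, $\mathfrak{a}S_X$ denotes its extension, i.e. the ideal of $S_X$ generated by the image of $\mathfrak{a}$. *)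

(* Defs.v *)
From HB Require Import structures.
From mathcomp Require Import all_boot all_algebra generic_quotient all_classical.
From mathcomp Require Import ring.

Set Implicit Arguments.
Unset Strict Implicit.
Unset Printing Implicit Defensive.

Import GRing.Theory.
Local Open Scope classical_set_scope.
Local Open Scope ring_scope.
Local Open Scope quotient_scope.

Section Ideals.
Variable S : comPzSemiRingType.
Implicit Types (a b : set S) (x y : S).

Definition is_ideal a : Prop :=
  [/\ a 0,
      forall x y, a x -> a y -> a (x + y)
    & forall s x, a x -> a (s * x)].

(* S carries no opposite: "y = -x" is rendered x + y = 0, which determines y. *)
Definition is_opp x y : Prop := x + y = 0.

Lemma is_opp_uniq x y z : is_opp x y -> is_opp x z -> y = z.
Proof.
rewrite /is_opp => xy xz.
by rewrite -[y]addr0 -xz addrA [y + x]addrC xy add0r.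
Qed.

Definition additively_invertible : set S := [set x | exists y, is_opp x y].

Definition is_semisubtractive a : Prop :=
  forall x, (a `&` additively_invertible) x ->
  forall y, is_opp x y -> (a `&` additively_invertible) y.

Definition is_proper_semisubtractive_ideal a : Prop :=
  [/\ is_ideal a, is_semisubtractive a & a != setT].

Definition is_maximal_semisubtractive a : Prop :=
  is_proper_semisubtractive_ideal a /\
  forall b, is_proper_semisubtractive_ideal b -> a `<=` b -> b = a.

Definition ideal_generated (G : set S) : set S := smallest is_ideal G.

End Ideals.

Arguments additively_invertible S : clear implicits.

Definition s_local (S : comNzSemiRingType) : Prop :=
  exists! m : set S, is_maximal_semisubtractive m.

Record multSet (S : comPzSemiRingType) := MultSet {
  mset : set S;
  mset1 : mset 1;
  msetM : forall x y, mset x -> mset y -> mset (x * y) }.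

(* The semiring of fractions a/x, with a/x = b/y iff z a y = z b x for some z
   in X, and the usual operations on fractions. 0 may belong to X, so the
   result is only a possibly zero semiring. *)
Module Localization.
Section Localization.
Variables (S : comPzSemiRingType) (X : multSet S).

Definition den := {x : S | `[< mset X x >]}.

Definition Den x (Xx : mset X x) : den := exist _ x (asboolT Xx).

Lemma denP (x : den) : mset X (sval x).
Proof. exact: asboolW (valP x). Qed.

Definition den1 : den := Den (mset1 X).
Definition denM (x y : den) : den := Den (msetM (denP x) (denP y)).

Definition frac := (S * den)%type.
Implicit Types p q r : frac.

Definition equiv p q : bool :=
  `[< exists2 z, mset X z & z * (p.1 * sval q.2) = z * (q.1 * sval p.2) >].

Lemma equiv_refl : reflexive equiv.
Proof. by move=> p; apply/asboolP; exists 1 => //; exact: mset1. Qed.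

Lemma equiv_sym : symmetric equiv.
Proof. by move=> p q; apply/asboolP/asboolP => -[z Xz e]; exists z. Qed.

Lemma equiv_trans : transitive equiv.
Proof.
move=> q p r /asboolP[z Xz e] /asboolP[t Xt f]; apply/asboolP.
exists (z * t * sval q.2); first by do 2?apply: msetM => //; exact: denP.
transitivity (t * sval r.2 * (z * (p.1 * sval q.2))); first by ring.
by rewrite e; transitivity (z * sval p.2 * (t * (q.1 * sval r.2)));
  [ring | rewrite f; ring].
Qed.

Canonical equiv_equiv := EquivRel equiv equiv_refl equiv_sym equiv_trans.

Definition type := {eq_quot equiv}.
HB.instance Definition _ : EqQuotient _ equiv type := EqQuotient.on type.
HB.instance Definition _ := Choice.on type.

Lemma equivP p q :
  reflect (exists2 z, mset X z & z * (p.1 * sval q.2) = z * (q.1 * sval p.2))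
          (p == q %[mod type]).
Proof. by rewrite eqmodE; exact: asboolP. Qed.

Lemma eq_pi p q : p.1 * sval q.2 = q.1 * sval p.2 -> \pi_type p = \pi_type q.
Proof. by move=> e; apply/eqP/equivP; exists 1; [exact: mset1 | rewrite e]. Qed.

Lemma repr_pi p : exists2 z, mset X z &
  z * (p.1 * sval (repr (\pi_type p)).2) =
  z * ((repr (\pi_type p)).1 * sval p.2).
Proof. by apply/equivP; rewrite reprK. Qed.

Definition addq p q : frac :=
  (p.1 * sval q.2 + q.1 * sval p.2, denM p.2 q.2).
Definition mulq p q : frac := (p.1 * q.1, denM p.2 q.2).

Definition add := lift_op2 type addq.
Definition mul := lift_op2 type mulq.
Definition zero : type := \pi_type (0, den1).
Definition one : type := \pi_type (1, den1).

Lemma pi_add : {morph \pi : p q / addq p q >-> add p q}.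
Proof.
move=> p q; unlock add; apply/eqP/equivP => /=.
have [z Xz e] := repr_pi p; have [t Xt f] := repr_pi q.
set p' := repr (\pi_type p) in e *; set q' := repr (\pi_type q) in f *.
exists (z * t); first exact: msetM.
transitivity (t * sval q.2 * sval q'.2 * (z * (p.1 * sval p'.2))
            + z * sval p.2 * sval p'.2 * (t * (q.1 * sval q'.2))); first by ring.
by rewrite e f; ring.
Qed.
Canonical pi_add_morph := PiMorph2 pi_add.

Lemma pi_mul : {morph \pi : p q / mulq p q >-> mul p q}.
Proof.
move=> p q; unlock mul; apply/eqP/equivP => /=.
have [z Xz e] := repr_pi p; have [t Xt f] := repr_pi q.
set p' := repr (\pi_type p) in e *; set q' := repr (\pi_type q) in f *.
exists (z * t); first exact: msetM.
transitivity ((z * (p.1 * sval p'.2)) * (t * (q.1 * sval q'.2))); first by ring.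
by rewrite e f; ring.
Qed.
Canonical pi_mul_morph := PiMorph2 pi_mul.

Lemma addA : associative add.
Proof.
elim/quotW=> p; elim/quotW=> q; elim/quotW=> r; rewrite !piE.
by apply: eq_pi => /=; ring.
Qed.

Lemma addC : commutative add.
Proof.
by elim/quotW=> p; elim/quotW=> q; rewrite !piE; apply: eq_pi => /=; ring.
Qed.

Lemma add0 : left_id zero add.
Proof.
by elim/quotW=> p; rewrite /zero !piE; apply: eq_pi => /=; ring.
Qed.

Lemma mulA : associative mul.
Proof.
elim/quotW=> p; elim/quotW=> q; elim/quotW=> r; rewrite !piE.
by apply: eq_pi => /=; ring.
Qed.

Lemma mulC : commutative mul.
Proof.
by elim/quotW=> p; elim/quotW=> q; rewrite !piE; apply: eq_pi => /=; ring.
Qed.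

Lemma mul1 : left_id one mul.
Proof.
by elim/quotW=> p; rewrite /one !piE; apply: eq_pi => /=; ring.
Qed.

Lemma mulDl : left_distributive mul add.
Proof.
elim/quotW=> p; elim/quotW=> q; elim/quotW=> r; rewrite !piE.
by apply: eq_pi => /=; ring.
Qed.

Lemma mul0 : left_zero zero mul.
Proof.
by elim/quotW=> p; rewrite /zero !piE; apply: eq_pi => /=; ring.
Qed.

HB.instance Definition _ := GRing.isNmodule.Build type addA addC add0.
HB.instance Definition _ :=
  GRing.Nmodule_isComPzSemiRing.Build type mulA mulC mul1 mulDl mul0.

End Localization.
End Localization.

HB.export Localization.

Notation localization := Localization.type.

Section LocalizationTheory.
Variables (S : comPzSemiRingType) (X : multSet S).

Definition fraction (a x : S) (Xx : mset X x) : localization X :=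
  \pi_(localization X) (a, Localization.Den Xx).

Definition to_localization (a : S) : localization X := fraction a (mset1 X).

Definition extended_ideal (a : set S) : set (localization X) :=
  ideal_generated (to_localization @` a).

Lemma fractionP (u : localization X) :
  exists a x (Xx : mset X x), u = fraction a Xx.
Proof.
elim/quotW: u => -[a [x /[dup] /asboolP Xx Xx']]; exists a, x, Xx.
by apply: Localization.eq_pi.
Qed.

Lemma fraction_eq (a b x y : S) (Xx : mset X x) (Xy : mset X y) :
  fraction a Xx = fraction b Xy <->
  exists2 z, mset X z & z * (a * y) = z * (b * x).
Proof.
by split=> [/eqP/Localization.equivP|?]; last apply/eqP/Localization.equivP.
Qed.

Lemma fractionD (a b x y : S) (Xx : mset X x) (Xy : mset X y) :
  fraction a Xx + fraction b Xy = fraction (a * y + b * x) (msetM Xx Xy).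
Proof.
rewrite {1}/GRing.add /= /fraction -Localization.pi_add.
exact: Localization.eq_pi.
Qed.

Lemma fractionM (a b x y : S) (Xx : mset X x) (Xy : mset X y) :
  fraction a Xx * fraction b Xy = fraction (a * b) (msetM Xx Xy).
Proof.
rewrite {1}/GRing.mul /= /fraction -Localization.pi_mul.
exact: Localization.eq_pi.
Qed.

End LocalizationTheory.

Arguments extended_ideal {S} X a%_classical_set_scope _.

Section Cancellable.
Variable S : comNzSemiRingType.

Definition cancellable : set S :=
  [set x | forall a b, x * a = x * b -> a = b].

Lemma cancellable1 : cancellable 1.
Proof. by move=> a b; rewrite !mul1r. Qed.

Lemma cancellableM x y :
  cancellable x -> cancellable y -> cancellable (x * y).
Proof. by move=> cx cy a b; rewrite -!mulrA => /cx/cy. Qed.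

Definition cancellable_mset : multSet S :=
  MultSet cancellable1 cancellableM.

(* An alias of the localization: as 0 is not cancellable when 0 != 1, it has
   in addition a nonzero semiring structure. *)
Definition cancellable_localization : Type := localization cancellable_mset.

HB.instance Definition _ := GRing.ComPzSemiRing.on cancellable_localization.

Lemma cancellable_localization_neq0 :
  (1 : cancellable_localization) != 0.
Proof.
apply/eqP => /fraction_eq[z cz]; rewrite !mulr1 mulr0 => z0.
have /cz/eqP : z * 1 = z * 0 by rewrite mulr1 mulr0.
by rewrite oner_eq0.
Qed.

HB.instance Definition _ := GRing.PzSemiRing_isNonZero.Build
  cancellable_localization cancellable_localization_neq0.

End Cancellable.

Arguments cancellable S : clear implicits.

(* Main.v *)
Require Import Defs.
From mathcomp Require Import all_boot all_algebra all_classical.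
From mathcomp Require Import ring.

(** The proper semisubtractive ideals of [S], ordered by inclusion, are closed
    under unions of nonempty chains, so by Zorn's lemma each of them lies in a
    maximal one. Uniqueness of the maximal one [m] therefore upgrades to:
    [m] is the greatest proper semisubtractive ideal
    ([s_local_greatest]). Being the greatest is what transfers to fractions.

    Let [X] be any multiplicative set disjoint from [m]. The extension of [m] is
    the set of fractions [a/x] with [a] in [m] ([extended_idealP]). It is
    semisubtractive, because a relation [a/x + b/y = 0] says that
    [z a y + z b x = 0] for some [z] in [X], an additive inversion in [S]
    between an element of [m] and a numerator of [b/y]; it is proper, because
    [a/x = 1] would put an element [z a = z x] in both [m] and [X]. Conversely a
    proper semisubtractive ideal [b] of the localization contracts to one of [S],
    hence the contraction lies in [m]; since [a/x] in [b] forces [a/1] in [b],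
    the ideal [b] lies in the extension of [m]. So this extension is the greatest
    proper semisubtractive ideal, which makes it the unique maximal one. The
    theorem is the case where [X] consists of the cancellable elements. *)

Set Implicit Arguments.
Unset Strict Implicit.
Unset Printing Implicit Defensive.

Import GRing.Theory.
Local Open Scope classical_set_scope.
Local Open Scope ring_scope.

Section SemisubtractiveIdeals.
Variable S : comPzSemiRingType.
Implicit Types (a b m : set S) (x y : S).

Lemma is_opp_sym x y : is_opp x y -> is_opp y x.
Proof. by rewrite /is_opp addrC. Qed.

Lemma ideal_neq_setT a : is_ideal a -> a != setT <-> ~ a 1.
Proof.
move=> [_ _ aM]; split=> [/eqP aNT a1|aN1]; last first.
  by apply/eqP => aT; apply: aN1; rewrite aT.
by apply: aNT; apply/seteqP; split=> // x _; rewrite -[x]mulr1; exact: aM.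
Qed.

Lemma semisubtractiveP a :
  is_semisubtractive a <-> forall x y, a x -> is_opp x y -> a y.
Proof.
split=> [ssa x y ax xy|ssa x [ax _] y xy].
  by have [] := ssa x (conj ax (ex_intro _ y xy)) y xy.
by split; [exact: ssa xy | exists x; exact: is_opp_sym].
Qed.

Lemma proper_semisubtractive_bigcup (F : set (set S)) :
  F !=set0 -> total_on F subset -> F `<=` @is_proper_semisubtractive_ideal S ->
  is_proper_semisubtractive_ideal (\bigcup_(a in F) a).
Proof.
move=> [a0 Fa0] Ftot Fp.
have idU : is_ideal (\bigcup_(a in F) a).
  split=> [|x y [a Fa ax] [b Fb bY]|s x [a Fa ax]].
  - by exists a0 => //; have [[]] := Fp _ Fa0.
  - have [ab|ba] := Ftot a b Fa Fb.
      by exists b => //; have [[_ bD _] _ _] := Fp b Fb; apply: bD => //; exact: ab.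
    by exists a => //; have [[_ aD _] _ _] := Fp a Fa; apply: aD => //; exact: ba.
  - by exists a => //; have [[_ _ aM] _ _] := Fp a Fa; exact: aM.
split=> //.
  apply/semisubtractiveP => x y [a Fa ax] xy; exists a => //.
  by have [_ /semisubtractiveP ssa _] := Fp a Fa; exact: ssa xy.
apply/(ideal_neq_setT idU) => -[a Fa a1].
by have [ida _ /(ideal_neq_setT ida)] := Fp a Fa.
Qed.

(** Zorn's lemma, applied to the sets [A] whose union with [b] is a proper
    semisubtractive ideal: this form of the condition holds for the union of
    the empty chain, which is the empty set. *)
Lemma maximal_semisubtractive_exists b : is_proper_semisubtractive_ideal b ->
  exists2 m, is_maximal_semisubtractive m & b `<=` m.
Proof.
move=> pb.
have [F FP Ftot|A [pA Amax]] :=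
    @Zorn_bigcup S (fun A => is_proper_semisubtractive_ideal (A `|` b)).
  pose G := [set A `|` b | A in set0 |` F].
  have -> : \bigcup_(A in F) A `|` b = \bigcup_(A in G) A.
    apply/seteqP; split=> x.
      move=> [[A FA Ax]|bx]; last by exists (set0 `|` b); [exists set0 => //; left | right].
      by exists (A `|` b); [exists A => //; right | left].
    by move=> [_ [A [->|FA] <-] [Ax|bx]] //; by [right | left; exists A].
  apply: proper_semisubtractive_bigcup.
  - by exists (set0 `|` b); exists set0 => //; left.
  - move=> _ _ [A FA <-] [B FB <-].
    have [AB|BA] : A `<=` B \/ B `<=` A.
      case: FA FB => [->|FA] [->|FB]; [by left|by left|by right|exact: Ftot].
    + by left; exact: setSU.
    + by right; exact: setSU.
  - by move=> _ [A [->|FA] <-]; [rewrite set0U | exact: FP].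
exists (A `|` b); last exact: subsetUr.
split=> // c pc Abc; apply/seteqP; split=> // x cx.
have cb : c `|` b = c by apply/setUidPl; exact: subset_trans Abc.
have [cA|cNA] := pselect (c `<=` A); first by left; exact: cA.
by case: (Amax c); [split=> // y Ay; apply: Abc; left | rewrite cb].
Qed.

Lemma greatest_unique_maximal m : is_proper_semisubtractive_ideal m ->
  (forall b, is_proper_semisubtractive_ideal b -> b `<=` m) ->
  unique (@is_maximal_semisubtractive S) m.
Proof.
move=> pm mgt; split=> [|n [pn nmax]]; last by apply: nmax => //; exact: mgt.
by split=> // b pb mb; apply/seteqP; split=> //; exact: mgt.
Qed.

End SemisubtractiveIdeals.

Lemma s_local_greatest (S : comNzSemiRingType) (m b : set S) :
  s_local S -> is_maximal_semisubtractive m ->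
  is_proper_semisubtractive_ideal b -> b `<=` m.
Proof.
move=> [n [_ nuniq]] mm /maximal_semisubtractive_exists[c cm].
by rewrite -(nuniq m mm) (nuniq c cm).
Qed.

Section LocalizedIdeals.
Variables (S : comPzSemiRingType) (X : multSet S).
Implicit Types (a m : set S) (b : set (localization X)).

Lemma fraction0 x (Xx : mset X x) : fraction 0 Xx = 0.
Proof. by apply/fraction_eq; exists 1; [exact: mset1 | rewrite !mul0r]. Qed.

Lemma to_localizationD x y :
  to_localization X (x + y) = to_localization X x + to_localization X y.
Proof.
rewrite fractionD; apply/fraction_eq; exists 1; first exact: mset1.
by rewrite !mulr1.
Qed.

Lemma to_localizationM x y :
  to_localization X (x * y) = to_localization X x * to_localization X y.
Proof.
rewrite fractionM; apply/fraction_eq; exists 1; first exact: mset1.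
by rewrite !mulr1.
Qed.

Lemma is_opp_fraction c d x y (Xx : mset X x) (Xy : mset X y) :
  is_opp (fraction c Xx) (fraction d Xy) <->
  exists2 z, mset X z & is_opp (z * (c * y)) (z * (d * x)).
Proof.
rewrite /is_opp fractionD -(fraction0 (mset1 X)) fraction_eq.
by split=> -[z Xz e]; exists z => //; move: e; rewrite mul0r mulr0 mulr1 mulrDr.
Qed.

(** A sum of multiples of images of elements of [a] can be put over a common
    denominator, and its numerator then stays in [a]. *)
Lemma extended_idealP a (ida : is_ideal a) u :
  extended_ideal X a u <->
  exists c x (Xx : mset X x), a c /\ u = fraction c Xx.
Proof.
have [a0 aD aM] := ida.
pose E v := exists c x (Xx : mset X x), a c /\ v = fraction c Xx.
split=> [/(_ E)|[c [x [Xx [ac ->]]]] b [[_ _ bM] ab]]; last first.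
  have -> : fraction c Xx = fraction 1 Xx * to_localization X c.
    rewrite fractionM; apply/fraction_eq; exists 1; first exact: mset1.
    by ring.
  by apply: bM; apply: ab; exists c.
apply; split; last by move=> _ [c ac <-]; exists c, 1, (mset1 X).
split.
- by exists 0, 1, (mset1 X); rewrite fraction0.
- move=> _ _ [c [x [Xx [ac ->]]]] [d [y [Xy [ad ->]]]].
  rewrite fractionD; exists (c * y + d * x), (x * y), (msetM Xx Xy).
  by split=> //; apply: aD; rewrite mulrC; exact: aM.
- move=> s _ [d [y [Xy [ad ->]]]]; have [c [x [Xx ->]]] := fractionP s.
  rewrite fractionM; exists (c * d), (x * y), (msetM Xx Xy).
  by split=> //; exact: aM.
Qed.

Lemma extended_ideal_is_ideal a : is_ideal (extended_ideal X a).
Proof.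
split=> [b [[]]//|u v au av b bP|s u au b bP].
- by have [[_ bD _] _] := bP; apply: bD; [exact: au | exact: av].
- by have [[_ _ bM] _] := bP; apply: bM; exact: au.
Qed.

Lemma extended_ideal_proper_semisubtractive m :
  is_proper_semisubtractive_ideal m -> mset X `&` m = set0 ->
  is_proper_semisubtractive_ideal (extended_ideal X m).
Proof.
move=> [idm /semisubtractiveP ssm _] Xm0.
have [m0 mD mM] := idm; have idE := extended_ideal_is_ideal m.
split=> //.
  apply/semisubtractiveP => u v /(extended_idealP idm)[c [x [Xx [mc ->]]]].
  have [d [y [Xy ->]]] := fractionP v => /is_opp_fraction[z Xz opp].
  apply/(extended_idealP idm).
  exists (z * (d * x)), (z * (y * x)), (msetM Xz (msetM Xy Xx)); split.
    by apply: ssm opp; rewrite [c * y]mulrC mulrA; exact: mM.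
  by apply/fraction_eq; exists 1; [exact: mset1 | ring].
apply/(ideal_neq_setT idE) => /(extended_idealP idm)[c [x [Xx [mc]]]].
move/fraction_eq => [z Xz]; rewrite mul1r mulr1 => zxc.
suff : (mset X `&` m) (z * x) by rewrite Xm0.
by split; [exact: msetM | rewrite zxc; exact: mM].
Qed.

Lemma contraction_proper_semisubtractive b :
  is_proper_semisubtractive_ideal b ->
  is_proper_semisubtractive_ideal (to_localization X @^-1` b).
Proof.
move=> [idb /semisubtractiveP ssb /(ideal_neq_setT idb) bN1].
have [b0 bD bM] := idb.
have idc : is_ideal (to_localization X @^-1` b).
  split=> [|x y bx bY|s x bx] /=; first by rewrite /to_localization fraction0.
  - by rewrite to_localizationD; exact: bD.
  - by rewrite to_localizationM; exact: bM.
split=> //; last exact/(ideal_neq_setT idc).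
apply/semisubtractiveP => x y bx xy; apply: ssb bx _.
by rewrite /is_opp -to_localizationD xy /to_localization fraction0.
Qed.

(** Multiplying [c/x] by [x/1] brings its numerator into the contraction. *)
Lemma contraction_subset_extension m b : is_ideal m -> is_ideal b ->
  to_localization X @^-1` b `<=` m -> b `<=` extended_ideal X m.
Proof.
move=> idm [_ _ bM] bm u; have [c [x [Xx ->]]] := fractionP u => bu.
apply/(extended_idealP idm); exists c, x, Xx; split=> //; apply: bm => /=.
suff -> : to_localization X c = to_localization X x * fraction c Xx by exact: bM.
rewrite fractionM; apply/fraction_eq; exists 1; first exact: mset1.
by ring.
Qed.

End LocalizedIdeals.

Lemma unique_maximal_localization (S : comNzSemiRingType) (X : multSet S)
    (m : set S) :
  s_local S -> is_maximal_semisubtractive m -> mset X `&` m = set0 ->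
  unique (@is_maximal_semisubtractive (localization X)) (extended_ideal X m).
Proof.
move=> hS hm Xm0; have [pm _] := hm.
apply: greatest_unique_maximal.
  exact: extended_ideal_proper_semisubtractive.
move=> b pb; have [idm _ _] := pm; have [idb _ _] := pb.
apply: contraction_subset_extension => //; apply: s_local_greatest hS hm _.
exact: contraction_proper_semisubtractive.
Qed.

Theorem proposition2p14 (S : comNzSemiRingType) (m : set S)
    (hS : s_local S) (hm : is_maximal_semisubtractive m)
    (hX : cancellable S `&` m = set0) :
  s_local (cancellable_localization S) /\
  @is_maximal_semisubtractive (cancellable_localization S)
    (extended_ideal (cancellable_mset S) m).
Proof.
have um := @unique_maximal_localization S (cancellable_mset S) m hS hm hX.
by split; [exists (extended_ideal (cancellable_mset S) m) | case: um].
Qed.
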